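(* Consider deterministic automata $G$ over finite event sets $E$ with uncontrollable events $E_{uc}\subseteq E$, metrics $d$ on $E$ with values in $[0,1]$, and $\lambda\in[0,1]$. (1) For all such $G,E_{uc},d,\lambda$: if $K_1,K_2\subseteq L(G)$ are $\lambda$-controllable, then so is $K_1\cup K_2$. (2) If $K_1,K_2$ are $\lambda$-controllable, then $K_1\cap K_2$ need not be $\lambda$-controllable; that is, there exist $G,E_{uc},d,\lambda$ and $\lambda$-controllable languages $K_1,K_2\subseteq L(G)$ such that $K_1\cap K_2$ is not $\lambda$-controllable. (3) For all such $G,E_{uc},d,\lambda$ and $K\subseteq L(G)$: if $\widetilde K_1$ and $\widetilde K_2$ are two realizations of $K$, then so is $\widetilde K_1\cup\widetilde K_2$. But $\widetilde K_1\cap\widetilde K_2$ is not necessarily a realization of $K$; that is, there exist $G,E_{uc},d,\lambda,K$ and realizations $\widetilde K_1,\widetilde K_2$ of $K$ such that $\widetilde K_1\cap\widetilde K_2$ is not a realization of $K$.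
   Context: Setting. $E$ is a finite set of events, partitioned as $E=E_c\sqcup E_{uc}$ (controllable / uncontrollable events); $E^*$ is the set of finite strings over $E$ including the empty string $\epsilon$; $l(s)$ is the length of a string $s$; $\overline{L}$ is the prefix closure of a language $L\subseteq E^*$. $G=(Q,E,\delta,q_0)$ is a deterministic automaton with partial transition function $\delta:Q\times E\to Q$, extended to strings as usual, and $L(G)=\{s\in E^*:\delta(q_0,s)\text{ is defined}\}$ (a prefix closed language containing $\epsilon$). Metrics. $d$ is a metric on $E$ with values in $[0,1]$. Set $d(\epsilon,\epsilon)=0$ and $d(a,\epsilon)=d(\epsilon,a)=1$ for $a\in E$. For strings $s=s_1\cdots s_{l(s)}$, $t=t_1\cdots t_{l(t)}$, pad the shorter one with $\epsilon$'s and define $d(s,t)=\sum_{i=1}^{\max\{l(s),l(t)\}}2^{-i}d(s_i,t_i)$. For a string $s$ and a language $A$, $d(s,A)=\inf_{a\in A}d(s,a)$ if $A\neq\emptyset$ and $d(s,\emptyset)=1$. For languages $A,B$, $d(A,B)$ is the Hausdorff metric: $d(\emptyset,\emptyset)=0$, and otherwise $d(A,B)=\max\{\sup_{a\in A}d(a,B),\sup_{b\in B}d(b,A)\}$ (a supremum over the empty set being $0$). Controllability. A language $K\subseteq L(G)$ is controllable if $\overline{K}E_{uc}\cap L(G)\subseteq\overline{K}$. A language $K\subseteq L(G)$ is $\lambda$-controllable if there is a controllable language $\widetilde K\subseteq L(G)$ with $d(\widetilde K,K)\le\lambda$; such a $\widetilde K$ is called a realization of $K$. *)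

(* Defs.v *)
From mathcomp Require Import all_boot all_order all_algebra.
From mathcomp Require Import boolp classical_sets reals.

Set Implicit Arguments.
Unset Strict Implicit.
Unset Printing Implicit Defensive.

Import Order.TTheory GRing.Theory Num.Theory.
Local Open Scope classical_set_scope.
Local Open Scope ring_scope.

(* Strings over E are sequences [seq E], languages are sets of strings. *)

Record automaton (E : finType) := Automaton {
  state : Type;
  trans : state -> E -> option state;
  init : state
}.

Definition run (E : finType) (G : automaton E) (q : state G) (s : seq E) :
    option (state G) :=
  foldl (fun oq e => obind (fun q' => trans q' e) oq) (Some q) s.

Definition language (E : finType) (G : automaton E) : set (seq E) :=
  [set s | run (init G) s].

Definition prefix_closure (E : finType) (L : set (seq E)) : set (seq E) :=
  [set s | exists2 t, L t & prefix s t].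

Record unit_metric (R : realType) (E : finType) (d : E -> E -> R) : Prop :=
  UnitMetric {
  unit_metric_itv : forall a b, 0 <= d a b <= 1;
  unit_metric_eq0 : forall a b, d a b = 0 <-> a = b;
  unit_metric_sym : forall a b, d a b = d b a;
  unit_metric_triangle : forall a b c, d a c <= d a b + d b c
}.

Section Distances.
Context (R : realType) (E : finType) (d : E -> E -> R).

(* [None] plays the role of the padding symbol epsilon. *)
Definition event_dist (x y : option E) : R :=
  match x, y with
  | Some a, Some b => d a b
  | None, None => 0
  | _, _ => 1
  end.

(* [onth s i] is [None] past the end of s, which performs the padding.
   Positions start at 0 here, hence the weight 2^-(i+1). *)
Definition string_dist (s t : seq E) : R :=
  \sum_(i < maxn (size s) (size t)) 2 ^- i.+1 * event_dist (onth s i) (onth t i).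

Definition string_lang_dist (s : seq E) (A : set (seq E)) : R :=
  if A == set0 then 1 else inf [set string_dist s a | a in A].

(* [sup set0 = 0]; the other suprema and the infimum above are over nonempty
   bounded sets whenever d takes its values in [0, 1]. *)
Definition lang_dist (A B : set (seq E)) : R :=
  if (A == set0) && (B == set0) then 0
  else Num.max (sup [set string_lang_dist a B | a in A])
               (sup [set string_lang_dist b A | b in B]).

End Distances.

Section Controllability.
Context (R : realType) (E : finType) (G : automaton E) (Euc : set E).

Definition controllable (K : set (seq E)) : Prop :=
  K `<=` language G /\
  [set rcons s e | s in prefix_closure K & e in Euc] `&` language G
    `<=` prefix_closure K.

Definition realization (d : E -> E -> R) (lambda : R)
    (K K' : set (seq E)) : Prop :=
  controllable K' /\ lang_dist d K' K <= lambda.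

Definition lambda_controllable (d : E -> E -> R) (lambda : R)
    (K : set (seq E)) : Prop :=
  K `<=` language G /\ exists K', realization d lambda K K'.

End Controllability.

(* Main.v *)
(* Both union claims reduce to the pointwise form of a Hausdorff bound,
   [lang_dist_le], together with the monotonicity of the distance to a language.
   For the intersections, let G generate all binary strings.  If every event is
   uncontrollable, the strings which are empty or end with b form, for each b, a
   controllable language; the two languages meet in {epsilon}, while a nonempty
   controllable language contains a nonempty string, at distance at least 1/2 from
   epsilon.  If every event is controllable, {1} and {0} both realize {1} for
   lambda = 1/2, but their intersection is empty, at distance 1 from {1}. *)
Require Import Defs.
From mathcomp Require Import all_boot all_order all_algebra.
From mathcomp Require Import boolp classical_sets reals.
From mathcomp Require Import lra.

Import Order.TTheory GRing.Theory Num.Theory.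
Local Open Scope classical_set_scope.
Local Open Scope ring_scope.

Section HausdorffBounds.
Context {R : realType} {E : finType} {d : E -> E -> R}.
Context (d_metric : unit_metric d).

Lemma event_dist_itv x y : 0 <= event_dist d x y <= 1.
Proof.
by case: x y => [a|] [b|] /=; rewrite ?lexx ?ler01 ?(unit_metric_itv d_metric).
Qed.

Lemma string_dist_ge0 s t : 0 <= string_dist d s t.
Proof.
apply: sumr_ge0 => i _; apply: mulr_ge0; first by rewrite invr_ge0 exprn_ge0.
by have /andP[] := event_dist_itv (onth s i) (onth t i).
Qed.

Lemma string_dist_le1 s t : string_dist d s t <= 1.
Proof.
(* The first [n] weights add up to [1 - 2 ^- n]; unlike the bound 1, this one passes through the
   induction. *)
suff H n : \sum_(i < n) 2 ^- i.+1 * event_dist d (onth s i) (onth t i)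
    <= 1 - 2 ^- n :> R.
  by apply: le_trans (H _) _; rewrite gerBl invr_ge0 exprn_ge0.
elim: n => [|n IHn]; first by rewrite big_ord0 expr0 invr1 subrr.
rewrite big_ord_recr /=.
have p_ge0 : 0 <= 2 ^- n.+1 :> R by rewrite invr_ge0 exprn_ge0.
(* With both powers expressed through [2 ^- n.+1], the induction step becomes linear. *)
have p_half : 2 ^- n = 2 * 2 ^- n.+1 :> R.
  by rewrite exprS invfM mulrA divff ?mul1r ?pnatr_eq0.
have /andP[_ e_le1] := event_dist_itv (onth s n) (onth t n).
have := ler_piMr p_ge0 e_le1.
move: IHn; rewrite p_half; lra.
Qed.

Lemma string_dist_refl s : string_dist d s s = 0.
Proof.
apply: big1 => i _; case: (onth s i) => [a|] /=; last by rewrite mulr0.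
by rewrite (unit_metric_eq0 d_metric a a).2 ?mulr0.
Qed.

(** The first position compares an event with the padding symbol and alone contributes
    [2^-1 * 1]. *)
Lemma string_dist_cons_nil a s : 2^-1 <= string_dist d (a :: s) [::].
Proof.
rewrite /string_dist maxn0 /= big_ord_recl /= expr1 mulr1 lerDl.
apply: sumr_ge0 => i _; apply: mulr_ge0; first by rewrite invr_ge0 exprn_ge0.
by have /andP[] := event_dist_itv (onth (a :: s) (lift ord0 i))
  (onth [::] (lift ord0 i)).
Qed.

Lemma string_lang_dist_le s A a :
  A a -> string_lang_dist d s A <= string_dist d s a.
Proof.
move=> Aa; rewrite /string_lang_dist ifF; last first.
  by apply/eqP => A0; rewrite A0 in Aa.
apply: ge_inf; last by exists a.
by exists 0 => _ [b _ <-]; exact: string_dist_ge0.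
Qed.

Lemma string_lang_dist_le1 s A : string_lang_dist d s A <= 1.
Proof.
have [->|/set0P[a Aa]] := eqVneq A set0; last first.
  exact: le_trans (string_lang_dist_le _ _ _ Aa) (string_dist_le1 _ _).
by rewrite /string_lang_dist eqxx.
Qed.

(** An infimum over more strings is smaller. The default 1 for the empty language respects this,
    since no distance exceeds 1. *)
Lemma string_lang_dist_subset s A B :
  A `<=` B -> string_lang_dist d s B <= string_lang_dist d s A.
Proof.
move=> AB; rewrite [leRHS]/string_lang_dist; case: ifPn => [_|/set0P[a Aa]].
  exact: string_lang_dist_le1.
apply: lb_le_inf; first by exists (string_dist d s a), a.
by move=> _ [b Ab <-]; apply: string_lang_dist_le; exact: AB.
Qed.

(** All distances lie below 1, so each supremum over a nonempty language is a true least upper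
    bound. Nonnegativity of [lambda] covers the empty languages, where the value is 0 by
    convention. *)
Lemma lang_dist_le A B lambda : 0 <= lambda ->
  lang_dist d A B <= lambda <->
  (forall a, A a -> string_lang_dist d a B <= lambda) /\
  (forall b, B b -> string_lang_dist d b A <= lambda).
Proof.
move=> lambda_ge0.
have sup_le C D : sup [set string_lang_dist d c D | c in C] <= lambda <->
    forall c, C c -> string_lang_dist d c D <= lambda.
  split=> [le_lambda c Cc|le_lambda].
    apply: le_trans le_lambda; apply: ub_le_sup; last by exists c.
    by exists 1 => _ [b _ <-]; exact: string_lang_dist_le1.
  have [->|/set0P[c Cc]] := eqVneq C set0; first by rewrite image_set0 sup0.
  apply: ge_sup; first by exists (string_lang_dist d c D), c.
  by move=> _ [b Cb <-]; exact: le_lambda.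
rewrite /lang_dist; case: ifPn => [/andP[/eqP -> /eqP ->]|_].
  by split=> // _; split.
rewrite ge_max; split=> [/andP[/sup_le ? /sup_le ?] //|[/sup_le -> /sup_le ->] //].
Qed.

Lemma lang_dist_setU A B C D lambda : 0 <= lambda ->
  lang_dist d A C <= lambda -> lang_dist d B D <= lambda ->
  lang_dist d (A `|` B) (C `|` D) <= lambda.
Proof.
move=> l0 /(lang_dist_le _ _ _ l0)[AC CA] /(lang_dist_le _ _ _ l0)[BD DB].
apply/(lang_dist_le _ _ _ l0); split=> s [].
- by move=> /AC; apply: le_trans; apply: string_lang_dist_subset; exact: subsetUl.
- by move=> /BD; apply: le_trans; apply: string_lang_dist_subset; exact: subsetUr.
- by move=> /CA; apply: le_trans; apply: string_lang_dist_subset; exact: subsetUl.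
- by move=> /DB; apply: le_trans; apply: string_lang_dist_subset; exact: subsetUr.
Qed.

Lemma lang_dist_refl A : lang_dist d A A <= 0.
Proof.
apply/lang_dist_le => //; split=> a Aa;
  by rewrite -(string_dist_refl a) string_lang_dist_le.
Qed.

Lemma lang_dist_set1 s t lambda : 0 <= lambda ->
  string_dist d s t <= lambda -> string_dist d t s <= lambda ->
  lang_dist d [set s] [set t] <= lambda.
Proof.
move=> l0 st ts; apply/(lang_dist_le _ _ _ l0); split=> _ ->;
  [apply: le_trans st|apply: le_trans ts]; exact: string_lang_dist_le.
Qed.

(** If [A] were empty, any string of [B] would be at distance 1 from it by convention, above
    [lambda]. *)
Lemma lang_dist_lt1_neq0 A B lambda : 0 <= lambda < 1 ->
  B !=set0 -> lang_dist d A B <= lambda -> A !=set0.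
Proof.
move=> /andP[l0 l1] [b Bb] /(lang_dist_le _ _ _ l0)[_ /(_ b Bb)] bA.
apply/set0P; apply/negP => /eqP A0; move: bA.
by rewrite /string_lang_dist A0 eqxx leNgt l1.
Qed.

End HausdorffBounds.

(** A prefix of a string of the union is a prefix of a string of [A] or of [B], and that same
    language absorbs the uncontrollable event. *)
Lemma controllable_setU (E : finType) (G : automaton E) Euc A B :
  controllable G Euc A -> controllable G Euc B -> controllable G Euc (A `|` B).
Proof.
move=> [AG A_ctrl] [BG B_ctrl]; split; first by rewrite subUset.
move=> _ [[s [t ABt st] [e Euce <-]] Gse].
case: ABt => [At|Bt].
  have [|u Au pu] := A_ctrl (rcons s e); last by exists u => //; left.
  by split=> //; exists s; [exists t|exists e].
have [|u Bu pu] := B_ctrl (rcons s e); last by exists u => //; right.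
by split=> //; exists s; [exists t|exists e].
Qed.

Definition free_automaton (E : finType) : automaton E :=
  Automaton (fun (_ : unit) _ => Some tt) tt.

Lemma language_free_automaton (E : finType) :
  language (free_automaton E) = setT.
Proof.
apply/seteqP; split=> // s _; rewrite /language /run /=.
by elim: s.
Qed.

Lemma controllable_free_automaton (E : finType) Euc A :
  prefix_closure A = setT -> controllable (free_automaton E) Euc A.
Proof. by move=> A_dense; split; rewrite ?language_free_automaton ?A_dense. Qed.

Lemma controllable_set0 (E : finType) (G : automaton E) A :
  A `<=` language G -> controllable G set0 A.
Proof. by move=> AG; split=> // _ [[s _ [e []]]]. Qed.

Definition discrete_dist (R : realType) (E : finType) (a b : E) : R :=
  (a != b)%:R.

Lemma discrete_dist_metric (R : realType) (E : finType) :
  unit_metric (@discrete_dist R E).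
Proof.
rewrite /discrete_dist; split=> [a b|a b|a b|a b c].
- by case: eqP; rewrite /= lexx ler01.
- split=> [/eqP|->]; last by rewrite eqxx.
  by rewrite pnatr_eq0 eqb0 negbK => /eqP.
- by rewrite eq_sym.
(* If [a] and [c] differ, then [b] differs from at least one of them. *)
- have [->|ac] := eqVneq a c; first by rewrite addr_ge0 ?ler0n.
  rewrite -natrD ler_nat; have [ab|//] := eqVneq a b.
  by rewrite -ab ac.
Qed.

Lemma inter_lambda_controllable_counterexample (R : realType) :
  exists (E : finType) (G : automaton E) (Euc : set E)
         (d : E -> E -> R) (lambda : R) (K1 K2 : set (seq E)),
    [/\ unit_metric d, 0 <= lambda <= 1,
        lambda_controllable G Euc d lambda K1,
        lambda_controllable G Euc d lambda K2
      & ~ lambda_controllable G Euc d lambda (K1 `&` K2)].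
Proof.
have d_metric := discrete_dist_metric R bool.
pose G := free_automaton bool.
(* [last b [::] = b], so [K b] contains the empty string. *)
pose K (b : bool) : set (seq bool) := [set s | last b s = b].
have K_ctrl b : lambda_controllable G setT (@discrete_dist R bool) 0 (K b).
  split; first by rewrite language_free_automaton.
  exists (K b); split; last exact: lang_dist_refl.
  apply: controllable_free_automaton; apply/seteqP; split=> // s _.
  (* Any string enters [K b] after appending [b], so every string is a prefix of one in [K b]. *)
  by exists (rcons s b); [rewrite /K /= last_rcons|exact: prefix_rcons].
exists bool, G, setT, (@discrete_dist R bool), 0, (K true), (K false).
split=> //; first by rewrite lexx ler01.
(* The default of [last] matters only for the empty string; a nonempty string has a single last
   event. *)
have -> : K true `&` K false = [set [::]].
  apply/seteqP; split=> [[|b s] //= []|_ -> //].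
  by rewrite /K /= => ->.
move=> [_ [K' [[_ K'_ctrl] K'_dist]]].
have [||t K't] := lang_dist_lt1_neq0 d_metric _ _ _ _ _ K'_dist.
- by rewrite lexx ltr01.
- by exists [::].
(* The empty string is a prefix of [t], so controllability forces some string [u] of [K'] to begin
   with the uncontrollable event [true]. *)
have [|u K'u] := K'_ctrl [:: true].
  split; last by rewrite language_free_automaton.
  by exists [::]; [exists t; rewrite ?prefix0s|exists true].
case: u K'u => [//|b u] K'u _.
(* The distance from this nonempty string to the empty one would have to be 0, yet it is at least
   [2^-1]. *)
have [/(_ _ K'u) + _] := (lang_dist_le d_metric _ _ _ (lexx 0)).1 K'_dist.
rewrite /string_lang_dist ifF; last by apply/negbTE/set0P; exists [::].
rewrite image_set1 inf1 => /(le_trans (string_dist_cons_nil d_metric b u)).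
by rewrite leNgt invr_gt0 ltr0n.
Qed.

Lemma inter_realization_counterexample (R : realType) :
  exists (E : finType) (G : automaton E) (Euc : set E)
         (d : E -> E -> R) (lambda : R) (K K1' K2' : set (seq E)),
    [/\ unit_metric d, 0 <= lambda <= 1 /\ K `<=` language G,
        realization G Euc d lambda K K1',
        realization G Euc d lambda K K2'
      & ~ realization G Euc d lambda K (K1' `&` K2')].
Proof.
have d_metric := discrete_dist_metric R bool.
pose G := free_automaton bool.
have half_ge0 : 0 <= 2^-1 :> R by rewrite invr_ge0.
have half_lt1 : 2^-1 < 1 :> R by rewrite invf_lt1 ?ltr1n.
have K_real b : realization G set0 (@discrete_dist R bool) 2^-1
    [set [:: true]] [set [:: b]].
  split; first by apply: controllable_set0; rewrite language_free_automaton.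
  (* Strings of length 1 differ only at the position of weight [2^-1], which explains the choice of
     [lambda]. *)
  by apply: lang_dist_set1 => //; rewrite /string_dist big_ord1 /= expr1
    ler_piMr // lern1 leq_b1.
exists bool, G, set0, (@discrete_dist R bool), 2^-1.
exists [set [:: true]], [set [:: true]], [set [:: false]].
split=> //; first by rewrite half_ge0 ltW // language_free_automaton.
move=> [_ K'_dist].
(* As [2^-1 < 1], a realization of a nonempty language is nonempty, but no string equals both
   [[:: true]] and [[:: false]]. *)
have [||s [-> //]] := lang_dist_lt1_neq0 d_metric _ _ _ _ _ K'_dist.
- by rewrite half_ge0.
- by exists [:: true].
Qed.

Theorem proposition2 (R : realType) :
  (forall (E : finType) (G : automaton E) (Euc : set E)
          (d : E -> E -> R) (lambda : R) (K1 K2 : set (seq E)),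
      unit_metric d -> 0 <= lambda <= 1 ->
      lambda_controllable G Euc d lambda K1 ->
      lambda_controllable G Euc d lambda K2 ->
      lambda_controllable G Euc d lambda (K1 `|` K2))
  /\
  (exists (E : finType) (G : automaton E) (Euc : set E)
          (d : E -> E -> R) (lambda : R) (K1 K2 : set (seq E)),
      [/\ unit_metric d, 0 <= lambda <= 1,
          lambda_controllable G Euc d lambda K1,
          lambda_controllable G Euc d lambda K2
        & ~ lambda_controllable G Euc d lambda (K1 `&` K2)])
  /\
  (forall (E : finType) (G : automaton E) (Euc : set E)
          (d : E -> E -> R) (lambda : R) (K K1' K2' : set (seq E)),
      unit_metric d -> 0 <= lambda <= 1 -> K `<=` language G ->
      realization G Euc d lambda K K1' ->
      realization G Euc d lambda K K2' ->
      realization G Euc d lambda K (K1' `|` K2'))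
  /\
  (exists (E : finType) (G : automaton E) (Euc : set E)
          (d : E -> E -> R) (lambda : R) (K K1' K2' : set (seq E)),
      [/\ unit_metric d, 0 <= lambda <= 1 /\ K `<=` language G,
          realization G Euc d lambda K K1',
          realization G Euc d lambda K K2'
        & ~ realization G Euc d lambda K (K1' `&` K2')]).
Proof.
split.
  move=> E G Euc d lambda K1 K2 d_metric /andP[l0 _].
  move=> [K1G [A [A_ctrl A_dist]]] [K2G [B [B_ctrl B_dist]]].
  split; first by rewrite subUset.
  by exists (A `|` B); split; [exact: controllable_setU|exact: lang_dist_setU].
split; first exact: inter_lambda_controllable_counterexample.
split; last exact: inter_realization_counterexample.
move=> E G Euc d lambda K A B d_metric /andP[l0 _] KG.
move=> [A_ctrl A_dist] [B_ctrl B_dist]; split; first exact: controllable_setU.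
(* Writing [K] as its union with itself reduces the claim to the bound for two pairs of
   languages. *)
by rewrite -[K]setUid; exact: lang_dist_setU.
Qed.
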